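(* Let $R$ be a unitary ring, let $d\in R$ be regular and let $a\in R$ be invertible along $d$. Then the following statements are equivalent. (i) $a^{\parallel d}a=aa^{\parallel d}$. (ii) $da\in Rd$ and $ad\in dR$.
   Context: $R$ is an associative ring with unit $1$. For $c\in R$, $cR=\{cx: x\in R\}$ and $Rc=\{xc: x\in R\}$. An element $d$ is regular if there is $z\in R$ with $d=dzd$. An element $a$ is invertible along $d$ if there is $b\in R$ with $b=bab$, $bR=dR$ and $Rb=Rd$; such $b$ is unique and is denoted $a^{\parallel d}$. *)

(* Defs.v *)
From HB Require Import structures.
From mathcomp Require Import all_boot all_algebra.
From mathcomp Require Import boolp classical_sets.

Set Implicit Arguments.
Unset Strict Implicit.
Unset Printing Implicit Defensive.

Import GRing.Theory.
Local Open Scope classical_set_scope.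
Local Open Scope ring_scope.

(* [cR] and [Rc] *)
Definition right_principal (R : pzRingType) (c : R) : set R :=
  [set c * x | x in [set: R]].

Definition left_principal (R : pzRingType) (c : R) : set R :=
  [set x * c | x in [set: R]].

(* von Neumann regularity; unrelated to cancellability ([GRing.lreg]) *)
Definition vn_regular (R : pzRingType) (d : R) : Prop :=
  exists z : R, d = d * z * d.

Definition is_inverse_along (R : pzRingType) (a d b : R) : Prop :=
  [/\ b = b * a * b,
      right_principal b = right_principal d
    & left_principal b = left_principal d].

Definition invertible_along (R : pzRingType) (a d : R) : Prop :=
  exists b : R, is_inverse_along a d b.

(* [inverse_along a d] is a^{||d}; the value 0 is a default, taken only when
   [a] is not invertible along [d]. *)
Definition inverse_along (R : pzRingType) (a d : R) : R :=
  xget 0 [set b | is_inverse_along a d b].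

Lemma inverse_alongP (R : pzRingType) (a d : R) :
  invertible_along a d -> is_inverse_along a d (inverse_along a d).
Proof. by case=> b hb; apply: (xgetPex 0 (ex_intro _ b hb)). Qed.

Lemma is_inverse_along_uniq (R : pzRingType) (a d b c : R) :
  is_inverse_along a d b -> is_inverse_along a d c -> b = c.
Proof.
case=> hb rb lb [hc rc lc].
have : right_principal b c by rewrite rb -rc; exists 1; rewrite ?mulr1.
case=> x _ hx.
have : left_principal c b by rewrite lc -lb; exists 1; rewrite ?mul1r.
case=> y _ hy.
have bac_c : b * a * c = c by rewrite -hx mulrA -hb.
have bac_b : b * a * c = b by rewrite -hy -!mulrA (mulrA c) -hc.
by rewrite -bac_b.
Qed.

Lemma inverse_along_eq (R : pzRingType) (a d b : R) :
  is_inverse_along a d b -> inverse_along a d = b.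
Proof.
move=> hb; apply: (@is_inverse_along_uniq R a d) => //.
by apply: inverse_alongP; exists b.
Qed.

(* Main.v *)
Require Import Defs.
From mathcomp Require Import all_boot all_algebra.
From mathcomp Require Import boolp classical_sets.

(** Write [b] for the inverse of [a] along [d]. The condition that [d * a] lies
    in [R d] says that the left ideal [R d] is stable under right
    multiplication by [a], so it depends on this ideal only; since
    [R d = R b], it amounts to [b * a] lying in [R b]
    ([left_principal_stableP]). Symmetrically, [a * d] lies in [d R] exactly
    when [a * b] lies in [b R]. This reduces the theorem to a statement about
    the outer inverse [b] of [a] alone ([outer_inverse_commuteP]). There,
    [b = b * a * b] makes [a * b] a right identity on [R b] and [b * a] a left
    identity on [b R], so both [b * a] and [a * b] are equal to the product
    [b * a * (a * b)]. *)

Set Implicit Arguments.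
Unset Strict Implicit.
Unset Printing Implicit Defensive.

Import GRing.Theory.
Local Open Scope ring_scope.

(** Being stable under right multiplication by [a] can be tested on the
    generator of the ideal, because [(y * c) * a = y * (c * a)]. *)
Lemma left_principal_stableP (R : pzRingType) (a c : R) :
  left_principal c (c * a) <->
  (forall x, left_principal c x -> left_principal c (x * a)).
Proof.
split=> [[u _ uc] x [y _ <-] | stable].
  by exists (y * u) => //; rewrite -mulrA uc mulrA.
by apply: stable; exists 1; rewrite ?mul1r.
Qed.

Lemma right_principal_stableP (R : pzRingType) (a c : R) :
  right_principal c (a * c) <->
  (forall x, right_principal c x -> right_principal c (a * x)).
Proof.
split=> [[u _ cu] x [y _ <-] | stable].
  by exists (u * y) => //; rewrite mulrA cu mulrA.
by apply: stable; exists 1; rewrite ?mulr1.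
Qed.

Lemma outer_inverse_right_id (R : pzRingType) (a b x : R) :
  b = b * a * b -> left_principal b x -> x * (a * b) = x.
Proof. by move=> bab [y _ <-]; rewrite -mulrA (mulrA b) -bab. Qed.

Lemma outer_inverse_left_id (R : pzRingType) (a b x : R) :
  b = b * a * b -> right_principal b x -> b * a * x = x.
Proof. by move=> bab [y _ <-]; rewrite mulrA -bab. Qed.

(** If [b * a] lies in [R b], it is fixed by the right factor [a * b]; if
    [a * b] lies in [b R], it is fixed by the left factor [b * a]. Both
    facts evaluate the same product [b * a * (a * b)]. *)
Lemma outer_inverse_commuteP (R : pzRingType) (a b : R) :
  b = b * a * b ->
  (b * a = a * b <-> left_principal b (b * a) /\ right_principal b (a * b)).
Proof.
move=> bab; split=> [ba_ab | [Rb_ba bR_ab]].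
  by split; [exists a | exists a].
by rewrite -(outer_inverse_right_id bab Rb_ba) (outer_inverse_left_id bab bR_ab).
Qed.

Theorem theorem6p3 (R : pzRingType) (d a : R) :
  vn_regular d -> invertible_along a d ->
  (inverse_along a d * a = a * inverse_along a d
   <->
   left_principal d (d * a) /\ right_principal d (a * d)).
Proof.
move=> _ /inverse_alongP [bab bR_dR Rb_Rd].
rewrite left_principal_stableP right_principal_stableP -Rb_Rd -bR_dR.
rewrite -left_principal_stableP -right_principal_stableP.
exact: outer_inverse_commuteP.
Qed.
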